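(* Let $\Gamma$ be a signed graph on $n$ vertices and let $1\le k\le n$ be an integer. If $\Gamma$ is sign-symmetric, then its $k$-token signed graph $F_k(\Gamma)$ is also sign-symmetric.
   Context: All graphs are finite and simple. A signed graph $\Gamma=(G,\sigma)$ is a graph $G=(V,E)$ with a signature $\sigma:E\to\{+1,-1\}$. Its negation is $-\Gamma=(G,-\sigma)$. For $U\subseteq V$, the switching $\Gamma^U$ is the signed graph on $G$ obtained from $\Gamma$ by reversing the sign of every edge between $U$ and $V\setminus U$. An isomorphism of signed graphs is a graph isomorphism preserving edge signs. $\Gamma$ and $\Gamma'$ are switching isomorphic if $\Gamma'$ is isomorphic to $\Gamma^U$ for some $U\subseteq V$. $\Gamma$ is sign-symmetric if it is switching isomorphic to $-\Gamma$. The $k$-token signed graph $F_k(\Gamma)$ has as vertices the $k$-element subsets of $V$; two vertices $A,B$ are adjacent iff $A\,\Delta\, B=\{a,b\}$ with $a\in A$, $b\in B$, $ab\in E$, and the edge $AB$ then has sign $\sigma(ab)$. *)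

(* Defs.v *)
From HB Require Import structures.
From mathcomp Require Import all_boot all_order all_algebra.
Set Implicit Arguments.
Unset Strict Implicit.
Unset Printing Implicit Defensive.
Import GRing.Theory.
Local Open Scope ring_scope.

(* The signature lives on edges only: [sgn u v] carries no information, and
   is never constrained, when [u] and [v] are not adjacent. *)
Record signed_graph (V : finType) := SignedGraph {
  adj : rel V;
  sgn : V -> V -> int;
  adj_sym : symmetric adj;
  adj_irr : irreflexive adj;
  sgn_sym : forall u v, adj u v -> sgn u v = sgn v u;
  sgn_pm1 : forall u v, adj u v -> sgn u v = 1 \/ sgn u v = -1
}.

Section Operations.
Variables (V : finType) (G : signed_graph V).

Lemma negation_sgn_sym u v : adj G u v -> - sgn G u v = - sgn G v u.
Proof. by move=> /sgn_sym ->. Qed.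

Lemma negation_sgn_pm1 u v :
  adj G u v -> - sgn G u v = 1 \/ - sgn G u v = -1.
Proof. by case/sgn_pm1=> ->; [right | left; rewrite opprK]. Qed.

Definition negation : signed_graph V :=
  SignedGraph (adj_sym G) (adj_irr G) negation_sgn_sym negation_sgn_pm1.

Variable U : {set V}.

Definition switch_sgn (u v : V) : int :=
  if (u \in U) != (v \in U) then - sgn G u v else sgn G u v.

Lemma switch_sgn_sym u v : adj G u v -> switch_sgn u v = switch_sgn v u.
Proof. by move=> uv; rewrite /switch_sgn eq_sym (sgn_sym uv). Qed.

Lemma switch_sgn_pm1 u v :
  adj G u v -> switch_sgn u v = 1 \/ switch_sgn u v = -1.
Proof.
move=> uv; rewrite /switch_sgn; case: ifP => _; last exact: sgn_pm1.
exact: negation_sgn_pm1.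
Qed.

Definition switch : signed_graph V :=
  SignedGraph (adj_sym G) (adj_irr G) switch_sgn_sym switch_sgn_pm1.

End Operations.

Definition isomorphic (V W : finType) (G : signed_graph V)
    (H : signed_graph W) : Prop :=
  exists f : V -> W,
    [/\ bijective f,
        forall u v, adj H (f u) (f v) = adj G u v
      & forall u v, adj G u v -> sgn H (f u) (f v) = sgn G u v].

Definition switching_isomorphic (V W : finType) (G : signed_graph V)
    (H : signed_graph W) : Prop :=
  exists U : {set V}, isomorphic H (switch G U).

Definition sign_symmetric (V : finType) (G : signed_graph V) : Prop :=
  switching_isomorphic G (negation G).

Definition token_vertex (V : finType) (k : nat) : finType :=
  {A : {set V} | #|A| == k}.

Section TokenGraph.
Variables (V : finType) (G : signed_graph V) (k : nat).
Implicit Types A B : token_vertex V k.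

Definition symdiff (A B : {set V}) : {set V} := (A :\: B) :|: (B :\: A).

Definition token_move A B : pred (V * V) := fun p =>
  [&& p.1 \in val A, p.2 \in val B, symdiff (val A) (val B) == [set p.1; p.2]
    & adj G p.1 p.2].

Definition token_adj : rel (token_vertex V k) := fun A B =>
  [exists p, token_move A B p].

(* The pair picked here is unique, see [token_sgnE]. *)
Definition token_sgn A B : int :=
  if [pick p | token_move A B p] is Some p then sgn G p.1 p.2 else 1.

Lemma token_moveC A B a b : token_move A B (a, b) = token_move B A (b, a).
Proof.
rewrite /token_move /= [symdiff _ _]setUC [[set a; b]]setUC adj_sym.
by rewrite andbCA.
Qed.

Lemma token_moveD A B a b :
  token_move A B (a, b) -> val A :\: val B = [set a] /\ val B :\: val A = [set b].
Proof.
case/and4P=> /= aA bB /eqP AB ab.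
have mem x : (x \in symdiff (val A) (val B)) = (x == a) || (x == b).
  by rewrite AB !inE.
have nab : a != b by apply: contraTneq ab => ->; rewrite adj_irr.
have aNB : a \notin val B.
  by have := mem a; rewrite !inE eqxx aA; case: (a \in val B).
have bNA : b \notin val A.
  by have := mem b; rewrite !inE eqxx bB orbT; case: (b \in val A).
split; apply/setP=> x; have := mem x; rewrite !inE.
  have [->|_] := eqVneq x a; first by rewrite aNB aA.
  have [->|_] := eqVneq x b; first by rewrite bB.
  by case: (x \in val A) (x \in val B) => [] [].
have [->|_] := eqVneq x b; first by rewrite bNA bB.
have [->|_] := eqVneq x a; first by rewrite aA.
by case: (x \in val A) (x \in val B) => [] [].
Qed.

Lemma token_sgnE A B a b : token_move A B (a, b) -> token_sgn A B = sgn G a b.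
Proof.
move=> m; rewrite /token_sgn; case: pickP => [[c d] m'|/(_ (a, b))]; last first.
  by rewrite m.
have [Ea Eb] := token_moveD m; have [Ec Ed] := token_moveD m'.
have /set1_inj -> : [set a] = [set c] by rewrite -Ea -Ec.
by have /set1_inj -> : [set b] = [set d] by rewrite -Eb -Ed.
Qed.

Lemma token_adj_sym : symmetric token_adj.
Proof.
by move=> A B; apply/existsP/existsP=> -[[a b] m]; exists (b, a);
  rewrite token_moveC.
Qed.

Lemma token_adj_irr : irreflexive token_adj.
Proof.
move=> A; apply/existsP=> -[[a b] /token_moveD []].
by rewrite setDv => /setP/(_ a); rewrite !inE eqxx.
Qed.

Lemma token_sgn_sym A B : token_adj A B -> token_sgn A B = token_sgn B A.
Proof.
case/existsP=> -[a b] m; rewrite (token_sgnE m).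
have := m; rewrite token_moveC => /token_sgnE ->.
by apply: sgn_sym; case/and4P: m.
Qed.

Lemma token_sgn_pm1 A B :
  token_adj A B -> token_sgn A B = 1 \/ token_sgn A B = -1.
Proof.
case/existsP=> -[a b] m; rewrite (token_sgnE m).
by apply: sgn_pm1; case/and4P: m.
Qed.

Definition token_graph : signed_graph (token_vertex V k) :=
  SignedGraph token_adj_sym token_adj_irr token_sgn_sym token_sgn_pm1.

End TokenGraph.

(* Main.v *)
(* Let f be an isomorphism from -Γ to Γ^U.  Then A |-> f(A) is an isomorphism
   from -F_k(Γ) to F_k(Γ)^W, where W is the set of the A with |A ∩ U| odd:
   moving a token from a to b changes the parity of |A ∩ U| exactly when U
   separates a from b. *)
Require Import Defs.
From mathcomp Require Import all_boot all_order all_algebra.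

Set Implicit Arguments.
Unset Strict Implicit.
Unset Printing Implicit Defensive.

Section TokenGraphSwitch.
Variables (V : finType) (G : signed_graph V) (k : nat).
Implicit Types (A B : token_vertex V k) (U : {set V}).

Definition token_switch_set U : {set token_vertex V k} :=
  [set A | odd #|val A :&: U|].

Lemma token_move_switch A B a b U : token_move G A B (a, b) ->
  ((A \in token_switch_set U) != (B \in token_switch_set U))
    = ((a \in U) != (b \in U)).
Proof.
have odd1 x : odd #|[set x] :&: U| = (x \in U).
  case: (boolP (x \in U)) => xU.
    by rewrite (setIidPl _) ?sub1set // cards1.
  by rewrite disjoint_setI0 ?cards0 // disjoints1.
case/token_moveD=> AB BA; rewrite !inE.
(* Split [A :&: U] along [B] and [B :&: U] along [A]: the common part [A :&: B :&: U] cancels modulo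
   2, leaving only the traces of [[set a]] and [[set b]] on [U]. *)
rewrite -(cardsID (val B) (val A :&: U)) -(cardsID (val A) (val B :&: U)).
rewrite ![_ :&: U]setIC -!setIDA AB BA ![U :&: [set _]]setIC.
rewrite -!setIA !oddD !odd1.
rewrite [val B :&: val A]setIC.
by case: (odd _) (a \in U) (b \in U) => [] [] [].
Qed.

End TokenGraphSwitch.

Lemma imsetD (aT rT : finType) (f : aT -> rT) (A B : {set aT}) :
  injective f -> f @: (A :\: B) = f @: A :\: f @: B.
Proof.
move=> f_inj; apply/setP=> y; apply/imsetP/setDP=> [[x /setDP[xA xB] ->]|].
  by rewrite !mem_imset.
by case=> /imsetP[x xA ->]; rewrite mem_imset // => xB;
  exists x; rewrite // inE xB.
Qed.

Section TokenMap.
Variables (V : finType) (k : nat) (f : V -> V) (f_inj : injective f).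

Lemma token_map_subproof (A : token_vertex V k) : #|f @: val A| == k.
Proof. by rewrite card_imset // (valP A). Qed.

Definition token_map (A : token_vertex V k) : token_vertex V k :=
  Sub (f @: val A) (token_map_subproof A).

Lemma token_map_inj : injective token_map.
Proof. by move=> A B /(congr1 val) /(imset_inj f_inj) /val_inj. Qed.

Variable G : signed_graph V.
Hypothesis f_adj : forall u v, adj G (f u) (f v) = adj G u v.

(** Taking images under the injective [f] preserves and reflects membership, and commutes with
    symmetric difference. *)
Lemma token_move_map A B a b :
  token_move G (token_map A) (token_map B) (f a, f b) = token_move G A B (a, b).
Proof.
rewrite /token_move /= !mem_imset // f_adj; congr [&& _, _, _ & _].
rewrite /symdiff -!imsetD // -imsetU.
by rewrite -!imset_set1 -imsetU (inj_eq (imset_inj f_inj)).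
Qed.

Lemma token_adj_map A B :
  token_adj G (token_map A) (token_map B) = token_adj G A B.
Proof.
apply/existsP/existsP=> -[[a b] m]; last first.
  by exists (f a, f b); rewrite token_move_map.
(* The ends of a move between images lie in these images, which supplies their preimages under
   [f]. *)
case/and4P: (m) => /= /imsetP[a' _ Ea] /imsetP[b' _ Eb] _ _.
by exists (a', b'); rewrite -token_move_map -Ea -Eb.
Qed.

End TokenMap.

Theorem theorem5p2 (V : finType) (G : signed_graph V) (n : nat)
  (hn : #|V| = n) (k : nat) (hk : (1 <= k <= n)%N) :
  sign_symmetric G -> sign_symmetric (token_graph G k).
Proof.
case=> U [f [/bij_inj f_inj f_adj f_sgn]].
exists (token_switch_set k U), (token_map f_inj); split.
- exact: injF_bij (token_map_inj (f_inj := f_inj)).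
(* Negation and switching keep all edges, so [f] is an automorphism of the underlying graph. *)
- exact: token_adj_map.
move=> A B /existsP[[a b] m] /=.
have m' : token_move G (token_map f_inj A) (token_map f_inj B) (f a, f b).
  by rewrite token_move_map.
(* The parity test on the image sets becomes the test whether [U] separates [f a] from [f b]; what
   remains is the sign condition of [f] on the edge [a b]. *)
rewrite /switch_sgn (token_move_switch U m') /= (token_sgnE m) (token_sgnE m').
by case/and4P: m => _ _ _ /f_sgn.
Qed.
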